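(* For any $k\geq 3$ and finite $I\subseteq\mathbb{Z}^+$, there is a constant $c_{I,k}$ such that \[d_k(I,n)=c_{I,k}\,f_k(n)\left(1+O(n^{-0.49})\right)\] as $n\to\infty$, where the implied constant may depend on $k$ and $I$.
   Context: For $w\in S_n$, $D_k(w)$ is the set of indices $i$ with $1\le i\le n-k+1$ and $w(i)>w(i+1)>\cdots>w(i+k-1)$ (starting points of $k$-descents). $d_k(I,n)$ is the number of $w\in S_n$ with $D_k(w)=I$, and $f_k(n)=d_k(\emptyset,n)$. *)

(* Defs.v *)
From mathcomp Require Import all_boot all_order all_algebra all_fingroup.
From mathcomp Require Import finmap.

Set Implicit Arguments.
Unset Strict Implicit.
Unset Printing Implicit Defensive.

Local Open Scope nat_scope.
Local Open Scope fset_scope.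

(* One-line notation w(1) w(2) ... w(n). Since 'S_n acts on 'I_n = {0,..,n-1},
   values are shifted by one; w(i) is the entry of index i.-1. *)
Definition one_line (n : nat) (w : 'S_n) : seq nat :=
  [seq (val (w j)).+1 | j <- enum 'I_n].

(* The sequence w(i), w(i+1), ..., w(i+k-1), for 1 <= i and i + k <= n + 1. *)
Definition window (k n : nat) (w : 'S_n) (i : nat) : seq nat :=
  take k (drop i.-1 (one_line w)).

(* iota 1 (n.+1 - k) lists the i with 1 <= i <= n - k + 1; it is empty when
   n < k, which n - k + 1 with truncated subtraction would not give. *)
Definition Dset (k n : nat) (w : 'S_n) : {fset nat} :=
  [fset i in [seq i <- iota 1 (n.+1 - k) | sorted gtn (window k w i)]].

Definition dnum (k : nat) (I : {fset nat}) (n : nat) : nat :=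
  #|[set w : 'S_n | Dset k w == I]|.

Definition fnum (k n : nat) : nat := dnum k fset0 n.

(* Main.v *)
Require Import Defs.
From mathcomp Require Import all_boot all_order all_algebra all_fingroup.
From mathcomp Require Import finmap zify ring lra.
From mathcomp Require Import all_classical all_reals all_analysis.
Import Order.TTheory GRing.Theory Num.Theory.
Import numFieldNormedType.Exports.

(** Build permutations by appending a last letter and keeping the relative
    order of the others. Once the length exceeds all positions of [I] by [k],
    the descent set stays equal to [I] exactly when no further [k]-descent
    appears, and whether a letter may be appended depends only on the state:
    the rank of the last letter and the number of trailing descents, which is
    less than [K = k - 1]. So the state counts for [I] and those for the empty
    set satisfy the same linear recursion with nonnegative coefficients
    ([state_count_ascent], [state_count_descent]); only the initial data
    differ.

    The ratio of two positive solutions of such a recursion converges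
    geometrically as soon as the recursion mixes, by Birkhoff's contraction
    argument. Mixing means here that, whatever the nonnegative solution [h],
    its values at the states ending with an ascent to rank [i] lie between two
    constant multiples of [i * n! * L h], for one linear functional [L]
    ([window_le_ascent], [ascent_le_window]). The upper estimate holds because
    every state has at most one extension of a given last rank. The lower one
    uses [k >= 3]: a state ending with an ascent may be followed by a descent
    and an ascent, and since the counts at such states increase with the rank,
    these two steps reach every rank [i] with weight at least of order [i];
    summed over [i], this also compares the masses at nearby levels
    ([ascent_mass_lb]).

    If [m * G <= F <= M * G] at some level, applying both estimates to
    [F - m * G], [M * G - F] and [G] improves [m] and [M] after [2 * K + 3]
    levels so that [M - m] shrinks by the factor [1 - mixing_rate]
    ([ratio_contracts]). Hence the quotient of the totals converges at a
    geometric rate to some [c]. The same estimates, applied to [F] and [G]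
    themselves, provide the first [m], which is positive; so [c > 0] and the
    absolute error is also a relative one. The rate is far better than the one
    required. *)

Set Implicit Arguments.
Unset Strict Implicit.
Unset Printing Implicit Defensive.

(** * Appending a letter to a permutation *)

Local Open Scope nat_scope.

Fixpoint leading_ascents (s : seq nat) : nat :=
  if s is x :: t then
    if t is y :: _ then if x < y then (leading_ascents t).+1 else 0 else 0
  else 0.

Definition trailing_descents (s : seq nat) : nat := leading_ascents (rev s).

Lemma sorted_take_ltn m u : m < size u ->
  sorted ltn (take m.+1 u) = (m <= leading_ascents u).
Proof.
elim: m u => [|m IH] [|x [|y t]] //= hm.
have := IH (y :: t) hm => /= ->.
by case: ltnP.
Qed.

Lemma sorted_drop_gtn m s : m < size s ->
  sorted gtn (drop (size s - m.+1) s) = (m <= trailing_descents s).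
Proof.
move=> hm; rewrite /trailing_descents -sorted_take_ltn ?size_rev //.
by rewrite take_rev rev_sorted.
Qed.

Lemma leading_ascents_map (f : nat -> nat) s :
  {mono f : x y / x < y} -> leading_ascents (map f s) = leading_ascents s.
Proof.
move=> fm; elim: s => [|x [|y t] IH] //=.
by move: IH => /= ->; rewrite fm.
Qed.

(** [make_room j] is the relabelling of the old values that frees the value
    [j.+1] for a new last letter. *)
Definition make_room (j x : nat) : nat := x + (j < x).

Lemma make_room_mono j : {mono make_room j : x y / x < y}.
Proof. by move=> x y; rewrite /make_room; lia. Qed.

Lemma size_one_line n (w : 'S_n) : size (one_line w) = n.
Proof. by rewrite size_map size_enum_ord. Qed.

Lemma one_line_lift n (j : 'I_n.+1) (s : 'S_n) :
  one_line (lift_perm ord_max j s) = rcons (map (make_room j) (one_line s)) j.+1.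
Proof.
rewrite /one_line enum_ordSr map_rcons lift_perm_id -!map_comp; congr rcons.
apply: eq_map => i /=; have -> : widen_ord (leqnSn n) i = lift ord_max i.
  by apply: val_inj; rewrite /= /bump leqNgt ltn_ord.
by rewrite lift_perm_lift /= /bump /make_room; lia.
Qed.

Lemma last_one_line n (w : 'S_n) : 0 < n -> 0 < last 0 (one_line w) <= n.
Proof.
move=> hn; have : last 0 (one_line w) \in one_line w.
  by rewrite -nth_last mem_nth // size_one_line; lia.
by case/mapP => i _ ->; rewrite ltn_ord.
Qed.

Lemma trailing_descents_lift n (j : 'I_n.+1) (s : 'S_n) : 0 < n ->
  trailing_descents (one_line (lift_perm ord_max j s)) =
  if j < last 0 (one_line s) then (trailing_descents (one_line s)).+1 else 0.
Proof.
move=> hn; rewrite one_line_lift /trailing_descents rev_rcons -map_rev.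
have := size_one_line s; case/lastP: (one_line s) => [/= h|t y _]; first by lia.
rewrite last_rcons rev_rcons /= /make_room.
have -> : (j.+1 < y + (j < y)) = (j < y) by lia.
have := leading_ascents_map (y :: rev t) (@make_room_mono j).
by rewrite /= /make_room => ->.
Qed.

Lemma mem_Dset k n (w : 'S_n) i :
  (i \in Dset k w) = [&& 0 < i, i + k <= n.+1 & sorted gtn (window k w i)].
Proof.
rewrite /Dset in_fset /= mem_filter mem_iota andbC.
by case: sorted; rewrite ?andbF // !andbT; lia.
Qed.

Lemma mem_Dset_last k n (w : 'S_n) i : 0 < k -> i + k = n.+1 ->
  (i \in Dset k w) = (0 < i) && (k.-1 <= trailing_descents (one_line w)).
Proof.
move=> hk hi; rewrite mem_Dset hi leqnn /=; case: (posnP i) => //= i_gt0.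
rewrite -sorted_drop_gtn ?size_one_line; last by lia.
have -> : n - k.-1.+1 = i.-1 by lia.
by rewrite /window take_oversize // size_drop size_one_line; lia.
Qed.

(** Appending a letter is order preserving on the old letters, so it can only
    affect the one window that ends at the new letter. *)
Lemma mem_Dset_lift k n (j : 'I_n.+1) (s : 'S_n) i : 0 < k -> i + k != n.+2 ->
  (i \in Dset k (lift_perm ord_max j s)) = (i \in Dset k s).
Proof.
move=> hk hi; rewrite !mem_Dset; case: (posnP i) => //= i_gt0.
have -> : (i + k <= n.+2) = (i + k <= n.+1) by lia.
case: leqP => //= hik; rewrite /window one_line_lift -cats1.
rewrite drop_cat size_map size_one_line ifT; last by lia.
rewrite takel_cat; last by rewrite size_drop size_map size_one_line; lia.
rewrite -map_drop -map_take (@mono_sorted _ _ (make_room j) gtn gtn) //.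
by move=> x y; apply: make_room_mono.
Qed.

(** From length [n] on, no window completed by a further letter can start at a
    position of [I]. *)
Definition beyond (k : nat) (I : {fset nat}) (n : nat) : Prop :=
  k <= n /\ forall i, i \in I -> i + k <= n.

(** The window ending at the new letter starts beyond [I], so it must not be
    descending; being descending means that the trailing descents fill it. *)
Lemma Dset_lift_eq k I n (j : 'I_n.+1) (s : 'S_n) : 0 < k -> beyond k I n ->
  (Dset k (lift_perm ord_max j s) == I) =
  (Dset k s == I) &&
    (trailing_descents (one_line (lift_perm ord_max j s)) < k.-1).
Proof.
move=> hk [hkn hI]; set w := lift_perm _ _ _.
have notI i : i + k = n.+2 -> i \notin I by move=> e; apply/negP => /hI; lia.
have notS i : i + k = n.+2 -> i \notin Dset k s.
  by move=> e; rewrite mem_Dset e ltnn andbF.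
have memw i : i + k = n.+2 ->
    (i \in Dset k w) = (k.-1 <= trailing_descents (one_line w)).
  by move=> e; rewrite mem_Dset_last //; have -> : 0 < i by lia.
apply/eqP/andP => [eI|[/eqP eI lt]].
  split; last first.
    have e : n.+2 - k + k = n.+2 by lia.
    by rewrite ltnNge -(memw _ e) eI notI.
  apply/eqP/fsetP => i; have [e|ne] := eqVneq (i + k) n.+2.
    by rewrite (negbTE (notI _ e)) (negbTE (notS _ e)).
  by rewrite -(mem_Dset_lift j s hk ne) -/w eI.
apply/fsetP => i; have [e|ne] := eqVneq (i + k) n.+2.
  by rewrite (memw _ e) (negbTE (notI _ e)) leqNgt lt.
by rewrite (mem_Dset_lift j s hk ne) eI.
Qed.

(** Otherwise the last window would put a position beyond [I] into the descent
    set. This keeps the number of states per last letter equal to [k.-1]. *)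
Lemma trailing_descents_lt k I n (s : 'S_n) : 0 < k -> beyond k I n ->
  Dset k s = I -> trailing_descents (one_line s) < k.-1.
Proof.
move=> hk [hkn hI] eI; rewrite ltnNge; apply/negP => h.
have e : n.+1 - k + k = n.+1 by lia.
have := mem_Dset_last s hk e; rewrite h eI andbT => h'.
have : n.+1 - k \in I by rewrite h'; lia.
by move/hI; lia.
Qed.

(** * Counting permutations by state *)

(** The state of a permutation is its last letter [i.+1] together with its
    number [r] of trailing descents: exactly what decides which letters can
    be appended without creating a [k]-descent. *)
Definition state_count (k : nat) (I : {fset nat}) (n i r : nat) : nat :=
  \sum_(w : 'S_n | [&& Dset k w == I, last 0 (one_line w) == i.+1
                     & trailing_descents (one_line w) == r]) 1.

Lemma sum_fibres (T : finType) (P : pred T) (f : T -> nat) a b :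
  (forall x, P x -> a <= f x < b) ->
  \sum_(x | P x) 1 = \sum_(a <= i < b) \sum_(x | P x && (f x == i)) 1.
Proof.
move=> hf; rewrite (exchange_big_dep P) /=; last by move=> i x _ /andP[].
apply: eq_bigr => x Px; rewrite sum1_count.
rewrite (@eq_count _ _ (pred1 (f x))); last first.
  by move=> i /=; rewrite Px /= eq_sym.
by rewrite count_uniq_mem ?iota_uniq // mem_index_iota hf.
Qed.

(** Removing the last letter is a bijection, by injectivity and the count
    (n+1)! = (n+1) n!. *)
Lemma sum_perm_lift n (Q : pred 'S_n.+1) :
  \sum_(w | Q w) 1 =
  \sum_(j < n.+1) \sum_(s : 'S_n | Q (lift_perm ord_max j s)) 1.
Proof.
pose f (p : 'I_n.+1 * 'S_n) := lift_perm ord_max p.1 p.2.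
have f_inj : injective f.
  move=> [j s] [j' s'] /permP e.
  have ej : j = j' by have := e ord_max; rewrite !lift_perm_id.
  rewrite -ej in e *; congr pair; apply/permP => x.
  by have := e (lift ord_max x); rewrite !lift_perm_lift => /lift_inj.
have f_bij : bijective f.
  by apply: inj_card_bij f_inj _; rewrite card_prod !card_Sn card_ord factS.
rewrite (reindex f) /=; last exact: onW_bij.
by rewrite pair_big_dep.
Qed.

Lemma sum_state_count k I n (P : pred 'S_n) a b c d :
  (forall s, P s -> a <= (last 0 (one_line s)).-1 < b) ->
  (forall s, P s -> c <= trailing_descents (one_line s) < d) ->
  (forall s i r, a <= i < b -> c <= r < d ->
    P s && ((last 0 (one_line s)).-1 == i) && (trailing_descents (one_line s) == r)
    = [&& Dset k s == I, last 0 (one_line s) == i.+1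
                     & trailing_descents (one_line s) == r]) ->
  \sum_(s | P s) 1 = \sum_(a <= i < b) \sum_(c <= r < d) state_count k I n i r.
Proof.
move=> h1 h2 h3; rewrite (sum_fibres h1); apply: eq_big_nat => i hi.
rewrite (@sum_fibres _ _ (fun s => trailing_descents (one_line s)) c d).
  by apply: eq_big_nat => r hr; apply: eq_bigl => s; apply: h3.
by move=> s /andP[/h2].
Qed.

Lemma state_count_lift k I n i r (hi : i < n.+1) : 0 < k -> beyond k I n ->
  r < k.-1 ->
  state_count k I n.+1 i r =
  \sum_(s : 'S_n | (Dset k s == I) &&
    ((if i < last 0 (one_line s) then (trailing_descents (one_line s)).+1 else 0) == r)) 1.
Proof.
move=> hk bn hr; have n_gt0 : 0 < n by case: bn; lia.
rewrite /state_count sum_perm_lift (bigD1 (Ordinal hi)) //= [X in _ + X]big1.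
  rewrite addn0; apply: eq_bigl => s.
  rewrite Dset_lift_eq // trailing_descents_lift // one_line_lift last_rcons eqxx /=.
  by rewrite -andbA; congr andb; case: eqP => [->|_]; rewrite ?hr ?andbF.
move=> j /negbTE ji; rewrite big_pred0 // => s.
by rewrite one_line_lift last_rcons eqSS -(inj_eq val_inj) /= in ji *; rewrite ji andbF.
Qed.

Lemma state_count_ascent k I n i : 1 < k -> beyond k I n -> i <= n ->
  state_count k I n.+1 i 0 = \sum_(0 <= j < i) \sum_(r < k.-1) state_count k I n j r.
Proof.
move=> hk bn hi; have k_gt0 : 0 < k by lia.
have n_gt0 : 0 < n by case: bn; lia.
rewrite (@state_count_lift k I n i 0 hi) //; last by lia.
under [RHS]eq_bigr do rewrite -(big_mkord xpredT).
apply: sum_state_count => s.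
- have hl := last_one_line s n_gt0.
  by case: (ltnP i) => hil; rewrite ?andbF // => _; lia.
- by move=> /andP[/eqP /(trailing_descents_lt k_gt0 bn)].
move=> j r hj hr; have := last_one_line s n_gt0.
move: (last _ _) => l hl; case: (Dset k s == I) => //=.
congr andb; case: (ltnP i) => hil /=; lia.
Qed.

Lemma state_count_descent k I n i r : 1 < k -> beyond k I n -> i <= n ->
  r.+1 < k.-1 ->
  state_count k I n.+1 i r.+1 = \sum_(i <= j < n) state_count k I n j r.
Proof.
move=> hk bn hi hr; have k_gt0 : 0 < k by lia.
have n_gt0 : 0 < n by case: bn; lia.
rewrite (@state_count_lift k I n i r.+1 hi) //.
have one j : state_count k I n j r = \sum_(r <= r' < r.+1) state_count k I n j r'.
  by rewrite big_nat1.
under [RHS]eq_bigr do rewrite one.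
apply: sum_state_count => s.
- have hl := last_one_line s n_gt0.
  by case: (ltnP i) => hil; rewrite ?andbF // => _; lia.
- by case: (ltnP i) => _; rewrite ?andbF // => /andP[_]; lia.
move=> j r' hj hr'; have := last_one_line s n_gt0.
move: (last _ _) => l hl; case: (Dset k s == I) => //=.
case: (ltnP i) => hil /=; lia.
Qed.

Lemma dnum_state_count k I n : 0 < k -> beyond k I n ->
  dnum k I n = \sum_(0 <= i < n) \sum_(r < k.-1) state_count k I n i r.
Proof.
move=> hk bn; have n_gt0 : 0 < n by case: bn; lia.
rewrite /dnum -sum1dep_card.
under [RHS]eq_bigr do rewrite -(big_mkord xpredT).
apply: sum_state_count => s.
- by have := last_one_line s n_gt0; lia.
- by move/eqP/(trailing_descents_lt hk bn).
move=> i r hi hr; rewrite -andbA; congr andb; congr andb.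
by have := last_one_line s n_gt0; lia.
Qed.

Lemma fnum_gt0 k n : 1 < k -> 0 < fnum k n.
Proof.
move=> hk; rewrite /fnum /dnum card_gt0; apply/set0Pn; exists 1%g.
rewrite inE; apply/eqP/fsetP => i; rewrite in_fset0 mem_Dset.
apply/negP => /and3P[i_gt0 hi]; rewrite /window.
have -> : one_line (1%g : 'S_n) = iota 1 n.
  rewrite /one_line (iotaDl 1 0 n) -val_enum_ord -map_comp.
  by apply: eq_map => x /=; rewrite perm1 add1n.
rewrite drop_iota take_iota => hs.
have : 1 < minn k (n - i.-1) by lia.
by case: (minn _ _) hs => [|[|m]] //= /andP[]; lia.
Qed.

(** * Nonnegative solutions of the recursion *)

Local Open Scope classical_set_scope.
Local Open Scope ring_scope.

(** The recursion shared by the state counts of all index sets: an ascent to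
    rank [i] leaves any state of smaller rank and resets the number of
    descents, a descent raises that number and is forbidden once it is
    [K.-1]. *)
Definition evolves (R : realFieldType) (K n0 : nat) (h : nat -> nat -> nat -> R)
  : Prop :=
  forall n, (n0 <= n)%N -> forall i, (i <= n)%N ->
    h n.+1 i 0 = \sum_(0 <= j < i) \sum_(r < K) h n j r /\
    forall r, (r.+1 < K)%N -> h n.+1 i r.+1 = \sum_(i <= j < n) h n j r.

Definition nonneg_level (R : realFieldType) (K n : nat)
    (h : nat -> nat -> nat -> R) : Prop :=
  forall i r, (i < n)%N -> (r < K)%N -> 0 <= h n i r.

Definition level_total (R : realFieldType) (K : nat)
    (h : nat -> nat -> nat -> R) (n : nat) : R :=
  \sum_(0 <= i < n) \sum_(r < K) h n i r.

(** Dividing by n! makes the masses at different levels comparable: for state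
    counts it is the probability that a random permutation is counted and ends
    with an ascent. *)
Definition ascent_mass (R : realFieldType) (h : nat -> nat -> nat -> R) (n : nat)
  : R := (\sum_(0 <= i < n) h n i 0) / n`!%:R.

(** Every permutation counted at level [N] ended with an ascent at one of the
    levels [N - r], [r < K]; hence this mass controls the whole level. *)
Definition window_mass (R : realFieldType) (K : nat)
    (h : nat -> nat -> nat -> R) (N : nat) : R :=
  \sum_(r < K) ascent_mass h (N - r).

Lemma eq_ler (R : realFieldType) (x y : R) : x = y -> x <= y.
Proof. by move->. Qed.

Lemma factS_R (R : numDomainType) n : (n.+1)`!%:R = n.+1%:R * n`!%:R :> R.
Proof. by rewrite factS natrM. Qed.

Lemma fact_R_gt0 (R : numDomainType) n : 0 < n`!%:R :> R.
Proof. by rewrite ltr0n fact_gt0. Qed.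

Section NonnegativeEvolution.
Variables (R : realFieldType) (K n0 : nat) (h : nat -> nat -> nat -> R).
Hypotheses (hK : (1 < K)%N) (ev : evolves K n0 h) (h0 : nonneg_level K n0 h).

Let K_gt0 : (0 < K)%N. Proof. exact: ltnW. Qed.

Lemma evolves_ge0 n : (n0 <= n)%N -> nonneg_level K n h.
Proof.
move=> /subnK <-; elim: (n - n0)%N => [//|d IH] i r hi hr.
rewrite addSn in hi *; set m := (d + n0)%N in IH hi *.
have hm : (n0 <= m)%N by rewrite /m leq_addl.
have [e0 eS] := ev hm (hi : (i <= m)%N).
case: r hr => [|r] hr.
  rewrite e0 big_nat_cond; apply: sumr_ge0 => j /andP[/andP[_ hj] _].
  by apply: sumr_ge0 => r _; apply: IH; [apply: leq_trans hj _|].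
rewrite eS // big_nat_cond; apply: sumr_ge0 => j /andP[/andP[_ hj] _].
by apply: IH => //; apply: ltn_trans hr.
Qed.

Let slice_ge0 n j : (n0 <= n)%N -> (j < n)%N -> 0 <= \sum_(r < K) h n j r.
Proof. by move=> hn hj; apply: sumr_ge0 => r _; apply: evolves_ge0. Qed.

Let sum_ge0 n a b r : (n0 <= n)%N -> (b <= n)%N -> (r < K)%N ->
  0 <= \sum_(a <= j < b) h n j r.
Proof.
move=> hn hb hr; rewrite big_nat_cond; apply: sumr_ge0 => j /andP[/andP[_ hj] _].
by apply: evolves_ge0 => //; apply: leq_trans hb.
Qed.

Lemma level_total_ge0 n : (n0 <= n)%N -> 0 <= level_total K h n.
Proof.
move=> hn; rewrite /level_total big_nat_cond; apply: sumr_ge0.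
by move=> j /andP[/andP[_ hj] _]; apply: slice_ge0.
Qed.

Lemma ascent_mass_ge0 n : (n0 <= n)%N -> 0 <= ascent_mass h n.
Proof. by move=> hn; rewrite divr_ge0 ?ler0n // sum_ge0. Qed.

(** Each state has at most one continuation with last rank [i]. *)
Lemma slice_le_total n i : (n0 <= n)%N -> (i <= n)%N ->
  \sum_(r < K) h n.+1 i r <= level_total K h n.
Proof.
move=> hn hi; have [e0 eS] := ev hn hi.
rewrite /level_total (big_cat_nat (leq0n i) hi) /=.
case: K hK e0 eS (@slice_ge0 n) (@evolves_ge0 n hn) => // K' hK' e0 eS sl nn.
rewrite big_ord_recl e0 lerD2l exchange_big /= [leRHS]big_ord_recr /=.
rewrite -[leLHS]addr0 lerD //.
  by apply: ler_sum => r _; rewrite eS // ?ltnS.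
rewrite big_nat_cond; apply: sumr_ge0 => j /andP[/andP[_ hj] _].
exact: nn.
Qed.

Lemma level_totalS n : (n0 <= n)%N ->
  level_total K h n.+1 <= n.+1%:R * level_total K h n.
Proof.
move=> hn; rewrite {1}/level_total.
apply: (@le_trans _ _ (\sum_(0 <= i < n.+1) level_total K h n)).
  by apply: ler_sum_nat => i /andP[_ hi]; apply: slice_le_total.
by rewrite sumr_const_nat subn0 mulr_natl.
Qed.

Lemma level_total_decr N n : (n0 <= N)%N -> (N <= n)%N ->
  level_total K h n / n`!%:R <= level_total K h N / N`!%:R.
Proof.
move=> hN /subnK <-; elim: (n - N)%N => [//|d IH].
apply: le_trans IH; rewrite addSn ler_pdivrMr ?fact_R_gt0 //.
rewrite factS_R [_.+1%:R * _]mulrC mulrA divfK ?gt_eqF ?fact_R_gt0 // mulrC.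
by apply: level_totalS; rewrite (leq_trans hN) ?leq_addl.
Qed.

Lemma ascent_le_total n i : (n0 <= n)%N -> (i <= n.+1)%N ->
  h n.+2 i 0 <= i%:R * level_total K h n.
Proof.
move=> hn hi; have [-> _] := ev (leqW hn) hi.
apply: (@le_trans _ _ (\sum_(0 <= j < i) level_total K h n)).
  apply: ler_sum_nat => j /andP[_ hj]; apply: slice_le_total => //.
  by rewrite -ltnS (leq_trans hj).
by rewrite sumr_const_nat subn0 mulr_natl.
Qed.

(** A state with [r] trailing descents comes from an ascent state [r] levels
    earlier, and each of the [r] steps has at most as many choices as the
    factorial gains. *)
Lemma layer_decr n r : (n0 <= n)%N -> (r < K)%N ->
  (\sum_(0 <= i < n + r) h (n + r) i r) / (n + r)`!%:R <= ascent_mass h n.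
Proof.
move=> hn; elim: r => [|r IH] hr; first by rewrite addn0.
apply: le_trans (IH (ltnW hr)); rewrite addnS; set m := (n + r)%N.
have hm : (n0 <= m)%N by rewrite (leq_trans hn) ?leq_addr.
rewrite ler_pdivrMr ?fact_R_gt0 // factS_R [_.+1%:R * _]mulrC mulrA.
rewrite divfK ?gt_eqF ?fact_R_gt0 // mulrC.
apply: (@le_trans _ _ (\sum_(0 <= i < m.+1) \sum_(0 <= j < m) h m j r)).
  apply: ler_sum_nat => i /andP[_ hi]; have [_ ->] := ev hm (hi : (i <= m)%N) => //.
  rewrite [leRHS](big_cat_nat (leq0n i) hi) /= lerDr.
  exact: sum_ge0 (ltnW hr).
by rewrite sumr_const_nat subn0 mulr_natl.
Qed.

Lemma total_le_window N : (n0 + K <= N)%N ->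
  level_total K h N / N`!%:R <= window_mass K h N.
Proof.
move=> hN; rewrite /level_total exchange_big /= mulr_suml; apply: ler_sum => r _.
have hr : (r <= N)%N by have := ltn_ord r; lia.
rewrite -{1 2 3}(subnK hr); apply: layer_decr => //.
by have := ltn_ord r; lia.
Qed.

(** The rank [j] can be reached by an ascent from every state that can ascend
    to a smaller rank [i]. *)
Lemma ascent_homo n i j : (n0 < n)%N -> (i <= j)%N -> (j < n)%N ->
  h n i 0 <= h n j 0.
Proof.
case: n => // n hn hij hj.
have [-> _] := ev hn (leq_trans hij hj : (i <= n)%N).
have [-> _] := ev hn (hj : (j <= n)%N).
rewrite [leRHS](big_cat_nat (leq0n i) hij) /= lerDl.
rewrite big_nat_cond; apply: sumr_ge0 => l /andP[/andP[_ hl] _].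
by apply: slice_ge0 => //; lia.
Qed.

(** Chebyshev: a nondecreasing sequence has at least its proportional share on
    a final segment. *)
Lemma ascent_tail n j : (n0 < n)%N -> (j <= n)%N ->
  (n%:R - j%:R) / n%:R * (\sum_(0 <= l < n) h n l 0)
    <= \sum_(j <= l < n) h n l 0.
Proof.
move=> hn hj; have n_gt0 : 0 < n%:R :> R by rewrite ltr0n (leq_ltn_trans _ hn).
rewrite mulrAC ler_pdivrMr // (big_cat_nat (leq0n j) hj) /=.
set lo := \sum_(0 <= _ < j) _; set hi := \sum_(j <= _ < n) _.
suff : (n%:R - j%:R) * lo <= j%:R * hi by lra.
have -> : (n%:R - j%:R) * lo = \sum_(0 <= i < j) \sum_(j <= l < n) h n i 0.
  rewrite /lo mulr_sumr; apply: eq_bigr => i _.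
  by rewrite sumr_const_nat -natrB // mulr_natl.
have -> : j%:R * hi = \sum_(0 <= i < j) \sum_(j <= l < n) h n l 0.
  by rewrite sumr_const_nat subn0 mulr_natl.
apply: ler_sum_nat => i /andP[_ hi']; apply: ler_sum_nat => l /andP[jl ln].
by apply: ascent_homo => //; apply: leq_trans jl; apply: ltnW.
Qed.

(** Mixing in two steps: descend from an ascent state, then ascend to [i]. The
    first step is possible because [1 < K], that is, because [k >= 3]. The
    descent to a rank [j] is open to all ranks from [j] on, which carry at
    least the share [(n - j) / n] of the mass; summing over [j < i] gives the
    factor [i / 2], as [i <= n + 1]. *)
Lemma ascent_ge_mass n i : (n0 < n)%N -> (i <= n.+1)%N ->
  i%:R / 2%:R * (\sum_(0 <= l < n) h n l 0) <= h n.+2 i 0.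
Proof.
move=> hn hi; have n_gt0 : 0 < n%:R :> R by rewrite ltr0n (leq_ltn_trans _ hn).
have [-> _] := ev (leqW (ltnW hn)) hi.
have s_ge0 : 0 <= \sum_(0 <= l < n) h n l 0 by apply: sum_ge0 => //; apply: ltnW.
apply: (@le_trans _ _ (\sum_(0 <= j < i)
    (n%:R - j%:R) / n%:R * \sum_(0 <= l < n) h n l 0)); last first.
  apply: ler_sum_nat => j /andP[_ hj].
  have hjn : (j <= n)%N by rewrite -ltnS (leq_trans hj).
  apply: le_trans (ascent_tail hn hjn) _.
  have [_ e1] := ev (ltnW hn) hjn; rewrite -e1 //.
  rewrite (bigD1 (Ordinal hK)) //= lerDl; apply: sumr_ge0 => r _.
  by apply: evolves_ge0 => //; apply: leqW; apply: ltnW.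
rewrite -mulr_suml ler_wpM2r // -mulr_suml ler_pdivlMr //.
have -> : \sum_(0 <= j < i) (n%:R - j%:R) = i%:R * n%:R - i%:R * (i%:R - 1) / 2%:R :> R.
  elim: (i) => [|m IH]; first by rewrite big_nil; field.
  by rewrite big_nat_recr //= IH -(natr1 m); field.
have : i%:R <= n.+1%:R :> R by rewrite ler_nat.
rewrite -natr1 => hin; have : 0 <= i%:R :> R by rewrite ler0n.
nra.
Qed.

(** The sum over [i] of the two-step bound. *)
Lemma ascent_mass2 n : (n0 < n)%N -> ascent_mass h n / 4%:R <= ascent_mass h n.+2.
Proof.
move=> hn; rewrite /ascent_mass; set s := \sum_(0 <= l < n) h n l 0.
have f0 := fact_R_gt0 R n.
have f2 := fact_R_gt0 R n.+2.
rewrite [leRHS]mulrC ler_pdivlMl // !factS_R.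
apply: (@le_trans _ _ (\sum_(0 <= i < n.+2) i%:R / 2%:R * s)); last first.
  by apply: ler_sum_nat => i /andP[_ hi]; apply: ascent_ge_mass.
rewrite -!mulr_suml.
have -> : \sum_(0 <= i < n.+2) i%:R = n.+2%:R * n.+1%:R / 2%:R :> R.
  elim: (n.+1) => [|m IH]; first by rewrite big_nat1; field.
  by rewrite big_nat_recr //= IH -(natr1 m.+1) -(natr1 m); field.
by apply: eq_ler; field; rewrite gt_eqF.
Qed.

(** A three-step analogue, by one more ascent; it is needed to change the parity
    of the number of steps. *)
Lemma ascent_mass3 n : (n0 < n)%N -> ascent_mass h n / 12%:R <= ascent_mass h n.+3.
Proof.
move=> hn; rewrite /ascent_mass; set s := \sum_(0 <= l < n) h n l 0.
have f0 := fact_R_gt0 R n.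
have f2 := fact_R_gt0 R n.+3.
rewrite [leRHS]mulrC ler_pdivlMl // !factS_R.
have tri i : \sum_(0 <= j < i) j%:R = i%:R * (i%:R - 1) / 2%:R :> R.
  elim: i => [|m IH]; first by rewrite big_nil; field.
  by rewrite big_nat_recr //= IH -(natr1 m); field.
apply: (@le_trans _ _ (\sum_(0 <= i < n.+3) i%:R * (i%:R - 1) / 4%:R * s)); last first.
  apply: ler_sum_nat => i /andP[_ hi].
  have [-> _] := ev (leqW (leqW (ltnW hn))) (hi : (i <= n.+2)%N).
  apply: (@le_trans _ _ (\sum_(0 <= j < i) j%:R / 2%:R * s)).
    by rewrite -!mulr_suml tri; apply: eq_ler; field.
  apply: ler_sum_nat => j /andP[_ hj].
  apply: le_trans (ascent_ge_mass hn (_ : (j <= n.+1)%N)) _; first by lia.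
  rewrite (bigD1 (Ordinal K_gt0)) //= lerDl; apply: sumr_ge0 => r _.
  by apply: evolves_ge0 => //; lia.
rewrite -!mulr_suml.
have -> : \sum_(0 <= i < n.+3) i%:R * (i%:R - 1) = n.+3%:R * n.+2%:R * n.+1%:R / 3%:R :> R.
  elim: (n) => [|m IH]; first by rewrite !big_nat_recr ?big_nil //=; field.
  by rewrite big_nat_recr //= IH -(natr1 m.+2) -(natr1 m.+1) -(natr1 m); field.
by apply: eq_ler; field; rewrite gt_eqF.
Qed.

(** Every [d >= 2] is a sum of twos and threes. *)
Lemma ascent_mass_lb n d : (n0 < n)%N -> (1 < d)%N ->
  ascent_mass h n / 12%:R ^+ d <= ascent_mass h (n + d).
Proof.
move=> hn; have mge m : (n <= m)%N -> 0 <= ascent_mass h m.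
  by move=> hm; apply: ascent_mass_ge0; lia.
elim/ltn_ind: d => -[|[|[|[|d]]]] // IH _.
- rewrite addn2; apply: le_trans (ascent_mass2 hn); have := mge n (leqnn n); lra.
- rewrite addn3; apply: le_trans (ascent_mass3 hn); have := mge n (leqnn n); lra.
rewrite !addnS; apply: le_trans (ascent_mass2 (_ : (n0 < (n + d).+2)%N)); last by lia.
have := IH d.+2 (leqnSn _) isT; rewrite !addnS => {}IH.
rewrite ler_pdivlMr ?ltr0n //; apply: le_trans IH.
have e12 : 12%:R ^+ d.+4 = 144%:R * 12%:R ^+ d.+2 :> R by rewrite 2!exprS; ring.
rewrite e12 invfM.
have := mge n (leqnn n).
set x := ascent_mass h n => x0; set y := (12%:R ^+ d.+2)^-1.
have y0 : 0 <= y by rewrite invr_ge0 exprn_ge0.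
have := mulr_ge0 x0 y0; lra.
Qed.

End NonnegativeEvolution.

(** * Contraction of the ratio of two solutions *)

(** The proportion of the masses that is certain to be shared: a factor 1/12
    for each of at most [2 * K] levels, 1/2 from the two-step bound, and 1/K
    from averaging over the window. *)
Definition mixing_rate (R : realFieldType) (K : nat) : R :=
  (12%:R ^+ (2 * K))^-1 / (2 * K)%:R.

Lemma mixing_rate_gt0 (R : realFieldType) K : (0 < K)%N -> 0 < mixing_rate R K.
Proof. by move=> hK; rewrite divr_gt0 ?invr_gt0 ?exprn_gt0 // ltr0n muln_gt0. Qed.

Lemma mixing_rate_le1 (R : realFieldType) K : (0 < K)%N -> mixing_rate R K <= 1.
Proof.
move=> hK; rewrite /mixing_rate -invfM invf_le1 ?mulr_gt0 ?exprn_gt0 ?ltr0n ?muln_gt0 //.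
by rewrite mulr_ege1 ?exprn_ege1 ?ler1n ?muln_gt0.
Qed.

Section Sandwich.
Variables (R : realFieldType) (K n0 : nat) (h : nat -> nat -> nat -> R).
Hypotheses (hK : (1 < K)%N) (ev : evolves K n0 h) (h0 : nonneg_level K n0 h).

Lemma window_mass_ge0 N : (n0 + K <= N)%N -> 0 <= window_mass K h N.
Proof.
move=> hN; apply: sumr_ge0 => r _.
by apply: (ascent_mass_ge0 hK ev h0); have := ltn_ord r; lia.
Qed.

Lemma ascent_le_window N n i : (n0 + K <= N)%N -> (N <= n)%N -> (i <= n.+1)%N ->
  h n.+2 i 0 <= i%:R * n`!%:R * window_mass K h N.
Proof.
move=> hN hNn hi; have n0N : (n0 <= N)%N by lia.
apply: le_trans (ascent_le_total hK ev h0 (leq_trans n0N hNn) hi) _.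
rewrite -mulrA ler_wpM2l ?ler0n // mulrC -ler_pdivrMr ?fact_R_gt0 //.
apply: le_trans (level_total_decr hK ev h0 n0N hNn) _.
exact: (total_le_window hK ev h0).
Qed.

(** With [ascent_le_window], this makes the counts at ascent states
    proportional, up to [mixing_rate], to a profile [i * n!] which does not depend on [h].
    The same window [N] serves [K] consecutive levels, enough to determine
    all states of the last one. *)
Lemma window_le_ascent N n i : (n0 + K <= N)%N -> (N + 2 <= n <= N + K.+1)%N ->
  (i <= n.+1)%N ->
  mixing_rate R K * (i%:R * n`!%:R * window_mass K h N) <= h n.+2 i 0.
Proof.
move=> hN /andP[hn1 hn2] hi; have hn : (n0 < n)%N by lia.
apply: le_trans (ascent_ge_mass hK ev h0 hn hi).
have K0 : 0 < K%:R :> R by rewrite ltr0n ltnW.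
have hL : (12%:R ^+ (2 * K))^-1 * window_mass K h N <= K%:R * ascent_mass h n.
  have -> : K%:R * ascent_mass h n = \sum_(r < K) ascent_mass h n.
    by rewrite sumr_const card_ord mulr_natl.
  rewrite mulr_sumr.
  apply: ler_sum => r _; have rK := ltn_ord r.
  have hd : (1 < n - (N - r))%N by lia.
  have hNr : (n0 < N - r)%N by lia.
  have := ascent_mass_lb hK ev h0 hNr hd.
  rewrite subnKC; last by lia.
  apply: le_trans; rewrite mulrC ler_wpM2l ?(ascent_mass_ge0 hK ev h0) //; first lia.
  rewrite lef_pV2 ?posrE ?exprn_gt0 // ler_eXn2l ?ltr1n //; lia.
have -> : \sum_(0 <= l < n) h n l 0 = ascent_mass h n * n`!%:R.
  by rewrite divfK // gt_eqF ?fact_R_gt0.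
have -> : mixing_rate R K * (i%:R * n`!%:R * window_mass K h N) =
  i%:R * n`!%:R / (2%:R * K%:R) * ((12%:R ^+ (2 * K))^-1 * window_mass K h N).
  by rewrite /mixing_rate natrM invfM; ring.
have -> : i%:R / 2%:R * (ascent_mass h n * n`!%:R) =
   i%:R * n`!%:R / (2%:R * K%:R) * (K%:R * ascent_mass h n).
  by field; rewrite gt_eqF.
by rewrite ler_wpM2l // divr_ge0 ?mulr_ge0 ?ler0n.
Qed.

End Sandwich.

Definition lin_comb (R : realFieldType) (a b : R) (F G : nat -> nat -> nat -> R)
  : nat -> nat -> nat -> R := fun n i r => a * F n i r + b * G n i r.

Section LinComb.
Variables (R : realFieldType) (K n0 : nat) (F G : nat -> nat -> nat -> R) (a b : R).

Lemma evolves_comb : evolves K n0 F -> evolves K n0 G ->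
  evolves K n0 (lin_comb a b F G).
Proof.
move=> evF evG n hn i hi; rewrite /lin_comb.
have [-> eF] := evF n hn i hi; have [-> eG] := evG n hn i hi; split.
  rewrite !mulr_sumr -big_split /=; apply: eq_bigr => j _.
  by rewrite !mulr_sumr -big_split.
by move=> r hr; rewrite eF // eG // !mulr_sumr -big_split.
Qed.

Lemma window_mass_comb N : window_mass K (lin_comb a b F G) N =
  a * window_mass K F N + b * window_mass K G N.
Proof.
rewrite /window_mass !mulr_sumr -big_split /=; apply: eq_bigr => r _.
by rewrite /ascent_mass big_split /= -!mulr_sumr; ring.
Qed.

Lemma level_total_comb n : level_total K (lin_comb a b F G) n =
  a * level_total K F n + b * level_total K G n.
Proof.
rewrite /level_total !mulr_sumr -big_split /=; apply: eq_bigr => i _.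
by rewrite !mulr_sumr -big_split.
Qed.
End LinComb.

Lemma evolves_leq (R : realFieldType) K n0 n1 (h : nat -> nat -> nat -> R) :
  (n0 <= n1)%N -> evolves K n0 h -> evolves K n1 h.
Proof. by move=> h01 ev n hn; apply: ev; apply: leq_trans hn. Qed.

(** At level [p + K] a state with [r < K] trailing descents is a sum of ascent
    states of level [p + K - r]. *)
Lemma nonneg_of_ascent (R : realFieldType) K n0 p (h : nat -> nat -> nat -> R) :
  evolves K n0 h -> (n0 <= p)%N ->
  (forall l i, (p < l <= p + K)%N -> (i < l)%N -> 0 <= h l i 0) ->
  nonneg_level K (p + K) h.
Proof.
move=> ev hp fr.
suff nn r : (r < K)%N -> forall l i, (p + r < l <= p + K)%N -> (i < l)%N ->
    0 <= h l i r.
  by move=> i r hi hr; apply: nn => //; rewrite ltn_add2l hr leqnn.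
elim: r => [|r IH] hr l i; first by rewrite addn0; apply: fr.
case: l => // l /andP[hl1 hl2] hi.
have [_ ->] := ev l (ltac:(lia) : (n0 <= l)%N) i hi => //.
rewrite big_nat_cond; apply: sumr_ge0 => j /andP[/andP[_ hj] _].
by apply: IH => //; lia.
Qed.

(** [m * G <= F <= M * G] at level [n], in the form that the linearity of the
    recursion propagates. *)
Definition ratio_bounds (R : realFieldType) K n (F G : nat -> nat -> nat -> R)
  (m M : R) : Prop :=
  nonneg_level K n (lin_comb 1 (- m) F G) /\ nonneg_level K n (lin_comb (- 1) M F G).

(** The nonnegative evolution [F - m * G] puts at least a fixed share of its
    window mass on every ascent state, while [G] puts at most its window mass
    there, with the same profile: so some further multiple of [G] can be
    subtracted. *)
Lemma lower_ratio (R : realFieldType) K (F G : nat -> nat -> nat -> R) n0 m :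
  (1 < K)%N -> evolves K n0 F -> evolves K n0 G ->
  nonneg_level K n0 G -> nonneg_level K n0 (lin_comb 1 (- m) F G) ->
  0 < window_mass K G (n0 + K) ->
  nonneg_level K (n0 + (2 * K + 3))
    (lin_comb 1 (- (m + mixing_rate R K *
       (window_mass K F (n0 + K) / window_mass K G (n0 + K) - m))) F G).
Proof.
move=> hK evF evG G0 low LG; set N := (n0 + K)%N in LG *.
set LF := window_mass K F N; set L := window_mass K G N in LG *.
set e := mixing_rate R K.
have -> : (n0 + (2 * K + 3) = N + 3 + K)%N by rewrite /N; lia.
(* ascent states of the [K] levels above [N + 3]; each such level is [l + 2] for
   a level [l] to which the window estimates refer *)
apply: (@nonneg_of_ascent _ _ n0); [exact: evolves_comb|rewrite /N; lia|].
case=> [//|[|l]] i hl hi; first lia.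
have hi' : (i <= l.+1)%N by [].
have hNl : (N + 2 <= l <= N + K.+1)%N by lia.
have lo := window_le_ascent hK (evolves_comb 1 (-m) evF evG) low (leqnn N) hNl hi'.
have hNl' : (N <= l)%N by lia.
have up := ascent_le_window hK evG G0 (leqnn N) hNl' hi'.
move: lo up; rewrite window_mass_comb -/LF -/L -/e /lin_comb.
set s := i%:R * l`!%:R; set f := F _ _ _; set g := G _ _ _ => lo up.
have q0 : 0 <= LF / L - m.
  have := window_mass_ge0 hK (evolves_comb 1 (-m) evF evG) low (leqnn N).
  rewrite window_mass_comb -/LF -/L => h.
  by rewrite subr_ge0 ler_pdivlMr //; lra.
have e0 : 0 <= e by apply: ltW; apply: mixing_rate_gt0; apply: ltnW.
have : e * (LF / L - m) * g <= e * (LF / L - m) * (s * L).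
  by rewrite ler_wpM2l // mulr_ge0.
have -> : e * (LF / L - m) * (s * L) = e * (s * (1 * LF + - m * L)).
  by field; rewrite gt_eqF.
lra.
Qed.

Section Contraction.
Variables (R : realFieldType) (K : nat) (F G : nat -> nat -> nat -> R).
Hypothesis hK : (1 < K)%N.

Let K_gt0 : (0 < K)%N. Proof. exact: ltnW. Qed.

Lemma upper_ratio n0 M : evolves K n0 F -> evolves K n0 G ->
  nonneg_level K n0 G -> nonneg_level K n0 (lin_comb (- 1) M F G) ->
  0 < window_mass K G (n0 + K) ->
  nonneg_level K (n0 + (2 * K + 3))
    (lin_comb (- 1) (M - mixing_rate R K *
       (M - window_mass K F (n0 + K) / window_mass K G (n0 + K))) F G).
Proof.
move=> evF evG G0 up LG.
(* [M * G - F] is the lower difference of [- F] and [G] for the bound [- M] *)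
pose F' := lin_comb (- 1) 0 F G.
have evF' : evolves K n0 F' by apply: evolves_comb.
have low : nonneg_level K n0 (lin_comb 1 (- - M) F' G).
  move=> i r hi hr; have := up i r hi hr; rewrite /lin_comb /F' /lin_comb; lra.
have := lower_ratio hK evF' evG G0 low LG; rewrite window_mass_comb => res i r hi hr.
have := res i r hi hr; rewrite /lin_comb /F' /lin_comb; lra.
Qed.

(** The two gains are [mixing_rate] times the distances of [m] and of [M] from
    the ratio of window masses, so together they are [mixing_rate] times
    [M - m]. *)
Lemma ratio_contracts n0 m M : evolves K n0 F -> evolves K n0 G ->
  nonneg_level K n0 G -> ratio_bounds K n0 F G m M ->
  0 < window_mass K G (n0 + K) ->
  exists m' M', [/\ m <= m', M' - m' = (1 - mixing_rate R K) * (M - m) &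
    ratio_bounds K (n0 + (2 * K + 3)) F G m' M'].
Proof.
move=> evF evG G0 [low up] LG.
pose rho := window_mass K F (n0 + K) / window_mass K G (n0 + K).
exists (m + mixing_rate R K * (rho - m)), (M - mixing_rate R K * (M - rho)).
split; last by split; [apply: lower_ratio | apply: upper_ratio].
  rewrite lerDl; apply: mulr_ge0; first exact: ltW (mixing_rate_gt0 R K_gt0).
  rewrite subr_ge0 ler_pdivlMr //.
  have := window_mass_ge0 hK (evolves_comb 1 (- m) evF evG) low (leqnn _).
  by rewrite window_mass_comb; lra.
by ring.
Qed.

Lemma ratio_contracts_iter n0 m M q : evolves K n0 F -> evolves K n0 G ->
  nonneg_level K n0 G -> (forall n, (n0 <= n)%N -> 0 < level_total K G n) ->
  ratio_bounds K n0 F G m M ->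
  exists m' M', [/\ m <= m', M' - m' = (1 - mixing_rate R K) ^+ q * (M - m) &
    ratio_bounds K (n0 + q * (2 * K + 3)) F G m' M'].
Proof.
move=> evF evG G0 tG bnd.
elim: q => [|q [m1 [M1 [le1 w1 b1]]]].
  by exists m, M; rewrite mul0n addn0 expr0 mul1r.
set n1 := (n0 + q * (2 * K + 3))%N in b1.
have n01 : (n0 <= n1)%N by rewrite /n1 leq_addr.
have wG : 0 < window_mass K G (n1 + K).
  apply: lt_le_trans (total_le_window hK evG G0 (_ : n0 + K <= n1 + K)%N).
    by rewrite divr_gt0 ?fact_R_gt0 // tG; lia.
  by rewrite leq_add2r.
have [m2 [M2 [le2 w2 b2]]] := ratio_contracts (evolves_leq n01 evF)
  (evolves_leq n01 evG) (evolves_ge0 evG G0 n01) b1 wG.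
exists m2, M2; split; first exact: le_trans le2.
  by rewrite w2 w1 exprS mulrA.
by rewrite mulSn [(_ + q * _)%N]addnC addnA.
Qed.

End Contraction.

(** Positive window masses alone make [F] and [G] comparable, since both have
    the same profile; [m > 0] is what makes the limit of the ratio nonzero. *)
Lemma ratio_bounds_init (R : realFieldType) K n0 (F G : nat -> nat -> nat -> R) :
  (1 < K)%N -> evolves K n0 F -> evolves K n0 G ->
  nonneg_level K n0 F -> nonneg_level K n0 G ->
  0 < window_mass K F (n0 + K) -> 0 < window_mass K G (n0 + K) ->
  exists m M, 0 < m /\ ratio_bounds K (n0 + (2 * K + 3)) F G m M.
Proof.
move=> hK evF evG F0 G0 LF LG.
have low (A B : nat -> nat -> nat -> R) : nonneg_level K n0 A ->
    nonneg_level K n0 (lin_comb 1 (- 0) A B).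
  by move=> A0 i r hi hr; rewrite /lin_comb oppr0 mul0r mul1r addr0 A0.
have rate0 := mixing_rate_gt0 R (ltnW hK).
pose N := (n0 + K)%N.
pose m := mixing_rate R K * (window_mass K F N / window_mass K G N).
pose w := mixing_rate R K * (window_mass K G N / window_mass K F N).
have w0 : 0 < w by rewrite mulr_gt0 // divr_gt0.
exists m, w^-1; split; first by rewrite mulr_gt0 // divr_gt0.
split.
  by have := lower_ratio hK evF evG G0 (low _ _ F0) LG; rewrite subr0 add0r.
have := lower_ratio hK evG evF F0 (low _ _ G0) LF; rewrite subr0 add0r -/N -/w.
move=> res i r hi hr; have := res i r hi hr; rewrite /lin_comb => wle.
rewrite -(pmulr_rge0 _ w0) mulrDr [w * (w^-1 * _)]mulrA divff ?gt_eqF //; lra.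
Qed.

(** The limit is the supremum of all lower bounds of [F] against [G]. *)
Lemma total_ratio_converges (R : realType) K n0 (F G : nat -> nat -> nat -> R) :
  (1 < K)%N -> evolves K n0 F -> evolves K n0 G ->
  nonneg_level K n0 F -> nonneg_level K n0 G ->
  (forall n, (n0 <= n)%N -> 0 < level_total K F n) ->
  (forall n, (n0 <= n)%N -> 0 < level_total K G n) ->
  exists c B, 0 < c /\ forall q n, (n0 + q.+1 * (2 * K + 3) <= n)%N ->
    `|level_total K F n / level_total K G n - c|
       <= (1 - mixing_rate R K) ^+ q * B.
Proof.
move=> hK evF evG F0 G0 tF tG.
have wpos (A : nat -> nat -> nat -> R) : evolves K n0 A -> nonneg_level K n0 A ->
    (forall n, (n0 <= n)%N -> 0 < level_total K A n) -> 0 < window_mass K A (n0 + K).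
  move=> evA A0 tA; apply: lt_le_trans (total_le_window hK evA A0 (leqnn _)).
  by rewrite divr_gt0 ?fact_R_gt0 // tA; lia.
have [m [M [m0 b0]]] := ratio_bounds_init hK evF evG F0 G0
  (wpos _ evF F0 tF) (wpos _ evG G0 tG).
set n1 := (n0 + (2 * K + 3))%N in b0.
have n01 : (n0 <= n1)%N by rewrite leq_addr.
have evF1 := evolves_leq n01 evF; have evG1 := evolves_leq n01 evG.
have G1 := evolves_ge0 evG G0 n01.
have tG1 n : (n1 <= n)%N -> 0 < level_total K G n.
  by move=> hn; apply: tG; apply: leq_trans hn.
have loP p n x : (n0 <= p)%N -> (p <= n)%N -> nonneg_level K p (lin_comb 1 (- x) F G) ->
    x <= level_total K F n / level_total K G n.
  move=> hp hn x0; rewrite ler_pdivlMr; last by apply: tG; lia.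
  have := level_total_ge0 (evolves_comb 1 (- x) (evolves_leq hp evF)
    (evolves_leq hp evG)) x0 hn.
  by rewrite level_total_comb; lra.
have upP p n x : (n0 <= p)%N -> (p <= n)%N -> nonneg_level K p (lin_comb (- 1) x F G) ->
    level_total K F n / level_total K G n <= x.
  move=> hp hn x0; rewrite ler_pdivrMr; last by apply: tG; lia.
  have := level_total_ge0 (evolves_comb (- 1) x (evolves_leq hp evF)
    (evolves_leq hp evG)) x0 hn.
  by rewrite level_total_comb; lra.
pose low : set R := [set x | exists2 p, (n0 <= p)%N &
  nonneg_level K p (lin_comb 1 (- x) F G)].
have mlow : low m by exists n1 => //; case: b0.
have lowub p x : (n0 <= p)%N -> nonneg_level K p (lin_comb (- 1) x F G) -> ubound low x.
  move=> hp hx y [p' hp' hy].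
  apply: le_trans (loP p' (maxn p p') y hp' (leq_maxr _ _) hy) _.
  exact: upP hp (leq_maxl _ _) hx.
have hubM : ubound low M by apply: (lowub n1) => //; case: b0.
have hs : has_sup low by split; [exists m | exists M].
exists (sup low), (M - m); split.
  by apply: lt_le_trans m0 _; apply: ub_le_sup => //; case: hs.
move=> q n hn.
have [m' [M' [_ <- [lo up]]]] := ratio_contracts_iter hK q evF1 evG1 G1 tG1 b0.
set p := (n1 + _)%N in lo up.
have hp : (n0 <= p)%N by rewrite /p; lia.
have hpn : (p <= n)%N by rewrite /p /n1; lia.
have c1 : m' <= sup low by apply: ub_le_sup; [case: hs|exists p].
have c2 : sup low <= M' by apply: ge_sup; [case: hs|apply: lowub hp up].
have := loP p n m' hp hpn lo; have := upP p n M' hp hpn up.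
by rewrite ler_norml => *; apply/andP; split; lra.
Qed.

(** * Rate of convergence *)

(** Bernoulli's inequality for [(1 + x) ^+ q], as [1 - x <= (1 + x)^-1]. *)
Lemma expr_1B_le_inv (R : realFieldType) (x : R) q : 0 < x -> x <= 1 ->
  (1 - x) ^+ q <= (1 + q%:R * x)^-1.
Proof.
move=> x0 x1; elim: q => [|q IH]; first by rewrite expr0 mul0r addr0 invr1.
have q0 : 0 <= q%:R :> R by rewrite ler0n.
have d0 : 0 < 1 + q%:R * x by rewrite ltr_pwDl // mulr_ge0 // ltW.
have d1 : 0 < 1 + q.+1%:R * x by rewrite ltr_pwDl // mulr_ge0 ?ler0n // ltW.
rewrite exprS; apply: (@le_trans _ _ ((1 - x) * (1 + q%:R * x)^-1)).
  by rewrite ler_wpM2l // subr_ge0.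
rewrite ler_pdivrMr // mulrC ler_pdivlMr //.
rewrite -natr1; nra.
Qed.

(** Geometric convergence along blocks of length [2 * K + 3] is weakened to the
    rate [1 / n], which already beats the exponent of the theorem. *)
Lemma total_ratio_rate (R : realType) K n0 (F G : nat -> nat -> nat -> R) :
  (1 < K)%N -> evolves K n0 F -> evolves K n0 G ->
  nonneg_level K n0 F -> nonneg_level K n0 G ->
  (forall n, (n0 <= n)%N -> 0 < level_total K F n) ->
  (forall n, (n0 <= n)%N -> 0 < level_total K G n) ->
  exists c B, 0 < c /\ \forall n \near \oo,
    `|level_total K F n / level_total K G n - c| <= B / n%:R.
Proof.
move=> hK evF evG F0 G0 tF tG.
have [c [B [c0 hB]]] := total_ratio_converges hK evF evG F0 G0 tF tG.
set J := (2 * K + 3)%N in hB; set x := mixing_rate R K in hB.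
have x0 : 0 < x by apply: mixing_rate_gt0; lia.
have x1 : x <= 1 by apply: mixing_rate_le1; lia.
have B0 : 0 <= B.
  by have := hB 0 _ (leqnn _); rewrite expr0 mul1r; apply: le_trans.
exists c, (4%:R * J%:R / x * B); split=> //.
exists (2 * n0 + 2 * J)%N => // n /= hn.
pose q := ((n - n0) %/ J).-1.
have hJ : (0 < J)%N by rewrite /J addn3.
have hq : (n0 + q.+1 * J <= n)%N.
  have := leq_divM (n - n0) J.
  have : (0 < (n - n0) %/ J)%N by rewrite divn_gt0 //; lia.
  rewrite /q; case: (_ %/ _)%N => //= m _; lia.
apply: le_trans (hB q n hq) _.
rewrite [leRHS]mulrAC ler_wpM2r //; apply: le_trans (expr_1B_le_inv q x0 x1) _.
have n_gt0 : 0 < n%:R :> R by rewrite ltr0n; lia.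
have q0 : 0 <= q%:R :> R by rewrite ler0n.
have J0 : 0 < J%:R :> R by rewrite ltr0n.
have d0 : 0 < 1 + q%:R * x by rewrite ltr_pwDl // mulr_ge0 // ltW.
rewrite -[leLHS]div1r ler_pdivrMr //.
have -> : 4%:R * J%:R / x / n%:R * (1 + q%:R * x) =
    4%:R * J%:R * (1 + q%:R * x) / (x * n%:R) by field; rewrite !gt_eqF.
rewrite ler_pdivlMr; last by rewrite mulr_gt0.
rewrite mul1r.
(* [n - n0 < q.+2 * J] by the choice of [q], and [n0] is at most half of [n] *)
have : n%:R <= ((q.+2 * J) * 2)%:R :> R.
  rewrite ler_nat.
  have := ltn_ceil (n - n0) hJ.
  have : (0 < (n - n0) %/ J)%N by rewrite divn_gt0 //; lia.
  rewrite /q; case: (_ %/ _)%N => //= m _; lia.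
rewrite !natrM -2!natr1 => hnq.
apply: (@le_trans _ _ (x * ((q%:R + 1 + 1) * J%:R * 2))).
  by rewrite ler_wpM2l // ltW.
have : 0 <= J%:R * (1 - x) by rewrite mulr_ge0 ?subr_ge0 // ltW.
have : 0 <= J%:R * (q%:R * x) by rewrite !mulr_ge0 // ltW.
nra.
Qed.

Unset Implicit Arguments.

Theorem theorem5p1 (R : realType) (k : nat) (hk : (3 <= k)%N)
    (I : {fset nat}) (hI : forall i : nat, i \in I -> (0 < i)%N) :
  exists c : R, exists e : nat -> R,
    e =O_\oo (fun n : nat => (n%:R : R) `^ (- (49%:R / 100%:R))) /\
    \forall n \near \oo,
      (dnum k I n)%:R = c * (fnum k n)%:R * (1 + e n).
Proof.
pose n0 := (k + \max_(i <- enum_fset I) i)%N.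
pose K := k.-1; have hK : (1 < K)%N by rewrite /K; lia.
have k1 : (1 < k)%N by lia.
have bI n : (n0 <= n)%N -> beyond k I n.
  move=> hn; split; first by rewrite /n0 in hn; lia.
  move=> i iI; have hi : (i <= \max_(i <- enum_fset I) i)%N.
    exact: (@leq_bigmax_seq _ _ xpredT id).
  by rewrite /n0 in hn; lia.
have b0 n : (n0 <= n)%N -> beyond k fset0 n.
  by move=> hn; split; [rewrite /n0 in hn; lia | move=> i; rewrite in_fset0].
pose h (J : {fset nat}) n i r : R := (state_count k J n i r)%:R.
have evh J : (forall n, (n0 <= n)%N -> beyond k J n) -> evolves K n0 (h J).
  move=> bJ n hn i hi; rewrite /h; split.
    rewrite (state_count_ascent k1 (bJ n hn) hi) natr_sum; apply: eq_bigr => j _.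
    by rewrite natr_sum.
  by move=> r hr; rewrite (state_count_descent k1 (bJ n hn) hi) // natr_sum.
have h0 J : nonneg_level K n0 (h J) by move=> i r _ _; rewrite /h ler0n.
have tot J : (forall n, (n0 <= n)%N -> beyond k J n) ->
    forall n, (n0 <= n)%N -> level_total K (h J) n = (dnum k J n)%:R.
  move=> bJ n hn; rewrite (dnum_state_count (ltnW k1) (bJ n hn)).
  by rewrite natr_sum; apply: eq_bigr => i _; rewrite natr_sum.
have tG n : (n0 <= n)%N -> 0 < level_total K (h fset0) n.
  by move=> hn; rewrite (tot _ b0) // ltr0n; apply: fnum_gt0.
(* If no permutation of some length past [n0] has descent set [I], none of a larger
   length has, and [c = 0] works; otherwise both sequences stay positive. *)
have [[n1 hn1 d0]|pos] := pselect (exists2 n, (n0 <= n)%N & dnum k I n = 0%N).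
  exists 0, (fun=> 0); split; first by apply/eqO_exP; exists 1 => //;
    apply: filterE => n; rewrite normr0 mul1r.
  exists n1 => // n /= hn; rewrite !mul0r.
  have := level_total_decr hK (evh _ bI) (h0 I) hn1 hn.
  rewrite !tot ?bI // ?(leq_trans hn1) // d0 mul0r.
  rewrite pmulr_lle0 ?invr_gt0 ?fact_R_gt0 // => le0.
  by apply/eqP; rewrite eq_le le0 ler0n.
have tF n : (n0 <= n)%N -> 0 < level_total K (h I) n.
  move=> hn; rewrite (tot _ bI) // ltr0n lt0n; apply/negP => /eqP d0.
  by apply: pos; exists n.
have [c [B [c0 [n1 _ hB]]]] := total_ratio_rate hK (evh _ bI) (evh _ b0) (h0 _) (h0 _) tF tG.
exists c, (fun n => (dnum k I n)%:R / (c * (fnum k n)%:R) - 1); split; last first.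
  exists n0 => // n /= hn; have f0 : 0 < (fnum k n)%:R :> R by rewrite ltr0n fnum_gt0.
  by field; rewrite !gt_eqF.
have ebnd n : (n0 + n1 < n)%N ->
    `|(dnum k I n)%:R / (c * (fnum k n)%:R) - 1| <= `|B| / c * `|n%:R `^ (- (49%:R / 100%:R))|.
  move=> hn; have f0 : 0 < (fnum k n)%:R :> R by rewrite ltr0n fnum_gt0.
  have hn1 : (n1 <= n)%N by lia.
  have := hB n hn1; rewrite !tot // ?(leq_trans _ hn) -/(fnum k n); [|lia..].
  set a := (dnum k I n)%:R; set f := (fnum k n)%:R in f0 *.
  move=> le1.
  have -> : a / (c * f) - 1 = (a / f - c) / c by field; rewrite !gt_eqF.
  rewrite normrM [X in _ * X]gtr0_norm ?invr_gt0 // [leRHS]mulrAC.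
  rewrite ler_wpM2r ?invr_ge0 ?(ltW c0) //.
  apply: le_trans le1 _; apply: (@le_trans _ _ (`|B| / n%:R)).
    by rewrite ler_wpM2r ?invr_ge0 ?ler0n // ler_norm.
  rewrite ler_wpM2l // ger0_norm ?powR_ge0 // -[leLHS]powR_inv1 ?ler0n //.
  apply: ler_powR; [by rewrite ler1n; lia | lra].
(* the summand 1 only makes the constant positive when [B = 0] *)
apply/eqO_exP; exists (`|B| / c + 1); first by rewrite ltr_pwDr // divr_ge0 // ltW.
exists (n0 + n1).+1 => // n /= hn; apply: le_trans (ebnd n hn) _.
by rewrite ler_wpM2r // lerDl.
Qed.
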